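(* Let $Y$ be the unique positive root of $$(17+10\sqrt2)Y^2+(72+16\sqrt2)Y-(112+96\sqrt2)=0.$$ Let $\tau_{\square}$ be the infimum of $\rho$ over all instances with a square pan (with side and positive width allowed to vary) admitting a descending greedy execution that fails to place the lex-max set. Then $$1\le\tau_{\square}\le Y=1.684487745872346\ldots.$$ Moreover, there are four-ring counterexamples to best fit (instances on which best fit fails to place the lex-max set) with strictly decreasing rational radii, positive rational width and rational side, whose values of $\rho$ tend to $Y$ from above.
   Context: Model. Fix a width $w>0$ and a pan, here a square $[0,s]^2$ in the plane. An inventory is a finite list of radii $r_1>r_2>\dots>r_n>0$; ring $i$ has outer radius $r_i$ and a hole which is a disk of radius $\max(0,r_i-w)$. A placement of a set $S$ of rings is a forest: each ring of $S$ has as parent either the pan or another ring of $S$ with $r_{\mathrm{child}}\le r_{\mathrm{parent}}-w$, and the children of each common parent must be packable in the parent's region (the square, or a disk of radius $r-w$ for the hole of a ring of radius $r$), i.e. closed disks having the children's outer radii can be positioned inside that region with pairwise disjoint interiors. Feasibility depends only on the parent assignment (siblings may be rearranged freely). $S$ is feasible if it has a placement. The lex-max set is obtained by scanning the rings in decreasing radius and including ring $i$ whenever the already included rings together with $i$ form a feasible set. A descending greedy execution processes the rings in decreasing radius; when ring $i$ is processed, a container (the pan or the hole of an already placed ring) admits it if the container's current children together with ring $i$ are packable in it; the ring receives some admitting container as its permanent parent (chosen arbitrarily), and is skipped only if no container admits it. Best fit chooses the admitting container of smallest capacity, where the capacity of a hole is its radius and the capacity of the square is its inradius $s/2$. $\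rho=\max_i\bigl(\sum_{j>i}r_j\bigr)/r_i$.
   Formalization: The printed decimal Y = 1.684487745872346... is wrong in its last digit: the positive root of the displayed quadratic is 1.68448774587234807..., so the formal statement asserts 1.684487745872348 ≤ Y < 1.684487745872349 instead. *)

(* Defs.v *)
From HB Require Import structures.
From mathcomp Require Import all_boot all_order all_algebra.
From mathcomp Require Import all_classical all_reals all_analysis.
Import Order.TTheory GRing.Theory Num.Theory.
Import numFieldNormedType.Exports.

Set Implicit Arguments.
Unset Strict Implicit.
Unset Printing Implicit Defensive.

Local Open Scope classical_set_scope.
Local Open Scope ring_scope.

Section Geometry.
Variable R : realType.
Implicit Types (x y : R * R) (t s : R) (D : set (R * R)).

(* The library norm on R * R is the max norm, hence an explicit distance.
   The product topology used by the interiors below is the usual one. *)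
Definition eucl_dist x y : R :=
  Num.sqrt ((x.1 - y.1) ^+ 2 + (x.2 - y.2) ^+ 2).

Definition disk x t : set (R * R) := [set y | eucl_dist x y <= t].

Definition square s : set (R * R) :=
  [set y | 0 <= y.1 <= s /\ 0 <= y.2 <= s].

Definition packable (I : finType) (r : I -> R) (C : {set I}) D : Prop :=
  exists x : I -> R * R,
    (forall i, i \in C -> disk (x i) (r i) `<=` D) /\
    (forall i j, i \in C -> j \in C -> i != j ->
       (disk (x i) (r i))° `&` (disk (x j) (r j))° = set0).

End Geometry.

Record instance (R : realType) := Instance {
  nrings : nat;
  ring_radius : 'I_nrings -> R;
  ring_width : R;
  pan_side : R;
  ring_radius_gt0 : forall i, 0 < ring_radius i;
  ring_radius_decr : forall i j : 'I_nrings, (i < j)%N ->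
    ring_radius j < ring_radius i;
  ring_width_gt0 : 0 < ring_width;
  pan_side_gt0 : 0 < pan_side
}.

Arguments ring_radius {R} _ _.

Section Model.
Variables (R : realType) (P : instance R).

Local Notation ring := 'I_(nrings P).

(* None is the pan; Some j is the hole of ring j. *)
Definition container := option ring.

Definition hole_radius (j : ring) : R :=
  Num.max 0 (ring_radius P j - ring_width P).

Definition region (c : container) : set (R * R) :=
  if c is Some j then disk (0, 0) (hole_radius j) else square (pan_side P).

Definition capacity (c : container) : R :=
  if c is Some j then hole_radius j else pan_side P / 2.

(* Acyclicity of the parent relation, and the parent being another ring, follow
   from the radius inequality since radii strictly decrease along it. *)
Definition placement (S : {set ring}) (parent : ring -> container) : Prop :=
  (forall i j, i \in S -> parent i = Some j ->
     j \in S /\ ring_radius P i <= ring_radius P j - ring_width P) /\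
  (forall c : container,
     packable (ring_radius P) [set i in S | parent i == c]%SET (region c)).

Definition feasible (S : {set ring}) : Prop :=
  exists parent : ring -> container, placement S parent.

(* enum lists the indices in increasing order, i.e. by decreasing radius. *)
Definition lexmax : {set ring} :=
  foldl (fun S i => if `[< feasible (i |: S)%SET >] then (i |: S)%SET else S)
    finset.set0 (enum ring).

(* An execution is recorded by its decisions: a i = Some c if ring i receives
   the permanent parent c, and a i = None if ring i is skipped.  The state when
   ring i is processed is the restriction of a to the indices below i. *)
Definition decisions := ring -> option container.

Definition available (a : decisions) (i : ring) (c : container) : Prop :=
  if c is Some j then (j < i)%N /\ a j <> None else True.

Definition children_before (a : decisions) (i : ring) (c : container) :
  {set ring} := [set j : ring | (j < i)%N && (a j == Some c)]%SET.

Definition admits (a : decisions) (i : ring) (c : container) : Prop :=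
  available a i c /\
  packable (ring_radius P) (i |: children_before a i c)%SET (region c).

Definition greedy (a : decisions) : Prop :=
  forall i, if a i is Some c then admits a i c else forall c, ~ admits a i c.

Definition best_fit (a : decisions) : Prop :=
  greedy a /\
  forall i c c', a i = Some c -> admits a i c' -> capacity c <= capacity c'.

Definition placed (a : decisions) : {set ring} := [set i | a i != None]%SET.

Definition greedy_fails : Prop :=
  exists a : decisions, greedy a /\ placed a <> lexmax.

(* No tie can occur: an admitting hole has positive radius, distinct holes of
   positive radius have distinct radii, and the hole of a placed ring is
   narrower than the pan; hence best fit has exactly one execution. *)
Definition best_fit_fails : Prop :=
  exists a : decisions, best_fit a /\ placed a <> lexmax.

Definition rho : R :=
  \big[Num.max/0]_(i < nrings P)
    ((\sum_(j < nrings P | (i < j)%N) ring_radius P j) / ring_radius P i).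

End Model.

(* Extended real, so that an empty set of failing instances would give +oo. *)
Definition tau_square (R : realType) : \bar R :=
  ereal_inf [set (rho P)%:E | P in [set P : instance R | greedy_fails P]].

(* Main.v *)
Require Import Defs.
From HB Require Import structures.
From mathcomp Require Import all_boot all_order all_algebra.
From mathcomp Require Import all_classical all_reals all_analysis.
From mathcomp Require Import ring lra.
Import Order.TTheory GRing.Theory Num.Theory.
Import numFieldNormedType.Exports.

(** The lower bound is an exchange argument. If [rho < 1], every radius exceeds
    the sum of all smaller ones. Suppose that some placement of the lex-max set
    agrees with the greedy decisions made before ring [i], and that greedy puts
    [i] into a container [c] different from its parent in that placement. Move
    [i] to [c]; the smaller rings that were in [c] have total radius below that
    of [i], so they fit, side by side, into the disk that [i] has just left
    ([packable_refill], [exchange]). The new placement agrees with greedy one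
    step further. Moreover greedy cannot skip a ring of the lex-max set, whose
    parent still admits it, and cannot place another ring, since the lex-max set
    would have included it. Hence greedy places exactly the lex-max set
    ([greedy_places_lexmax]).

    The upper bound comes from radii [1 > b > c > d], width [1 - c - d], so that
    the hole of the largest ring has radius [c + d], and a square in which disks
    of radii [1] and [b] fit in opposite corners. All four rings can be placed:
    [1] and [b] in the pan, [c] and [d] in the hole of [1]. Best fit instead puts
    [b] into that hole, which sends [c] to the pan and leaves [d] without a
    place, provided that disks of radii [1], [c], [d] do not fit in the square.
    For [c] and [d] slightly above [t] they do not, as soon as a disk of radius
    [1] in the middle of a side blocks two disks of radius [t] in the opposite
    corners ([three_disks_not_in_square]). The hole of the ring [b] is too small
    for [c] and [d] if [b + c < 1]. The value of [rho] is then [(c + d) / b],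
    which exceeds [2 t / (1 - t)] and tends to it as [c] and [d] decrease to [t]
    and [b] increases to [1 - t]; for [t = Y / (Y + 2)] this limit is [Y], and
    equality in the blocking condition for the side [(1 + sqrt 2 / 2) (2 - t)]
    is the quadratic equation of the statement ([threshold_blocked]). Rational
    values that meet all the conditions exist arbitrarily close to this limit
    ([exists_failing_four_rings]). *)

Set Implicit Arguments.
Unset Strict Implicit.
Unset Printing Implicit Defensive.

Local Open Scope classical_set_scope.
Local Open Scope ring_scope.

(** * Disks and their interiors *)

Section Disks.
Variable R : realType.
Implicit Types (x y z : R * R) (a b s h : R).

Definition sqdist x y : R := (x.1 - y.1) ^+ 2 + (x.2 - y.2) ^+ 2.

Lemma diskE x a y : 0 <= a -> disk x a y <-> sqdist x y <= a ^+ 2.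
Proof.
move=> a0; rewrite /disk /= /eucl_dist -/(sqdist x y).
by rewrite -(@ler_sqr _ (Num.sqrt _)) ?nnegrE ?sqrtr_ge0 // sqr_sqrtr
  ?addr_ge0 ?sqr_ge0.
Qed.

(** An interior point can be pushed radially away from the centre without
    leaving the disk, so its distance to the centre is not yet the radius. *)
Lemma interior_disk_lt x a z : 0 < a -> (disk x a)° z -> sqdist x z < a ^+ 2.
Proof.
move=> a0 /nbhs_ballP[e /= e0 zb].
have [->|xz] := eqVneq x z.
  by rewrite /sqdist !subrr expr0n addr0 exprn_gt0.
pose m := 1 + `|z.1 - x.1| + `|z.2 - x.2|.
have m0 : 0 < m by rewrite /m; have := normr_ge0 (z.1 - x.1);
  have := normr_ge0 (z.2 - x.2); lra.
pose d := e / 2 / m.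
have d0 : 0 < d by rewrite !divr_gt0.
have near_z u : `|u| <= m -> `|d * u| < e.
  move=> um; rewrite normrM gtr0_norm //.
  rewrite (@le_lt_trans _ _ (d * m)) ?ler_pM2l //.
  by rewrite /d divfK ?gt_eqF //; lra.
have : disk x a (z.1 + d * (z.1 - x.1), z.2 + d * (z.2 - x.2)).
  apply: zb; split; rewrite /ball /= opprD addrA subrr add0r normrN;
    apply: near_z; rewrite /m;
    have := normr_ge0 (z.1 - x.1); have := normr_ge0 (z.2 - x.2); lra.
move/(diskE _ _ (ltW a0)); rewrite /sqdist /= => le_a.
have pos : 0 < (x.1 - z.1) ^+ 2 + (x.2 - z.2) ^+ 2.
  rewrite lt_neqAle eq_sym paddr_eq0 ?addr_ge0 ?sqr_ge0 // !sqrf_eq0 !subr_eq0.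
  by rewrite andbT; move: xz; rewrite -pair_eqE.
apply: lt_le_trans le_a.
have -> : (x.1 - (z.1 + d * (z.1 - x.1))) ^+ 2 +
  (x.2 - (z.2 + d * (z.2 - x.2))) ^+ 2 =
  (1 + d) ^+ 2 * ((x.1 - z.1) ^+ 2 + (x.2 - z.2) ^+ 2) by ring.
rewrite ltr_pMl // -subr_gt0.
have -> : (1 + d) ^+ 2 - 1 = d * (2 + d) by ring.
by rewrite mulr_gt0 //; lra.
Qed.

Lemma lt_interior_disk x a z : 0 < a -> sqdist x z < a ^+ 2 -> (disk x a)° z.
Proof.
move=> a0 xz.
have cont : sqdist x y @[y --> z] --> sqdist x z.
  apply: cvgD; rewrite /=; under eq_fun do rewrite expr2.
  - rewrite expr2; apply: cvgM; apply: cvgB; (try exact: cvg_cst);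
      exact: cvg_fst.
  - rewrite expr2; apply: cvgM; apply: cvgB; (try exact: cvg_cst);
      exact: cvg_snd.
rewrite /interior; near=> y.
apply/diskE; rewrite ?ltW //.
by near: y; apply: (cvgr_lt _ cont).
Unshelve. all: by end_near.
Qed.

(** Strict triangle inequality in the plane; the mixed term is controlled by
    Lagrange's identity. *)
Lemma sqsumD_lt (p1 p2 q1 q2 a b : R) : 0 < a -> 0 < b ->
  p1 ^+ 2 + p2 ^+ 2 < a ^+ 2 -> q1 ^+ 2 + q2 ^+ 2 < b ^+ 2 ->
  (p1 + q1) ^+ 2 + (p2 + q2) ^+ 2 < (a + b) ^+ 2.
Proof.
move=> a0 b0 pa qb.
have dot : p1 * q1 + p2 * q2 <= a * b.
  have [dot0|dot0] := leP (p1 * q1 + p2 * q2) 0.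
    by rewrite (le_trans dot0) // mulr_ge0 ?ltW.
  rewrite -ler_sqr ?nnegrE ?mulr_ge0 ?(ltW a0) ?(ltW b0) ?(ltW dot0) // exprMn.
  have lagrange : (p1 * q1 + p2 * q2) ^+ 2 + (p1 * q2 - p2 * q1) ^+ 2 =
    (p1 ^+ 2 + p2 ^+ 2) * (q1 ^+ 2 + q2 ^+ 2) by ring.
  have := sqr_ge0 (p1 * q2 - p2 * q1).
  have := ltr_pM (addr_ge0 (sqr_ge0 p1) (sqr_ge0 p2))
    (addr_ge0 (sqr_ge0 q1) (sqr_ge0 q2)) pa qb.
  lra.
have -> : (p1 + q1) ^+ 2 + (p2 + q2) ^+ 2 =
  p1 ^+ 2 + p2 ^+ 2 + (q1 ^+ 2 + q2 ^+ 2) + 2 * (p1 * q1 + p2 * q2) by ring.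
have -> : (a + b) ^+ 2 = a ^+ 2 + b ^+ 2 + 2 * (a * b) by ring.
lra.
Qed.

(** If the centres are too close, the point dividing their segment in the ratio
    of the radii is interior to both disks; conversely, a common interior point
    and the triangle inequality bring the centres close. *)
Lemma interior_disjointP x y a b : 0 < a -> 0 < b ->
  (disk x a)° `&` (disk y b)° = set0 <-> (a + b) ^+ 2 <= sqdist x y.
Proof.
move=> a0 b0; split=> [dis|far].
  rewrite leNgt; apply/negP => close.
  have ab0 : 0 < a + b by rewrite addr_gt0.
  pose la := a / (a + b); pose lb := b / (a + b).
  have lab : la + lb = 1 by rewrite /la /lb; field; rewrite gt_eqF.
  pose z : R * R := (lb * x.1 + la * y.1, lb * x.2 + la * y.2).
  have xz : sqdist x z = la ^+ 2 * sqdist x y.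
    by rewrite /sqdist /z /=; (have -> : lb = 1 - la by lra); ring.
  have yz : sqdist y z = lb ^+ 2 * sqdist x y.
    by rewrite /sqdist /z /=; (have -> : la = 1 - lb by lra); ring.
  suff : set0 z by [].
  rewrite -dis; split; apply: lt_interior_disk => //.
    rewrite xz; have -> : a ^+ 2 = la ^+ 2 * (a + b) ^+ 2.
      by rewrite -exprMn divfK ?gt_eqF.
    by rewrite ltr_pM2l // exprn_gt0 // divr_gt0.
  rewrite yz; have -> : b ^+ 2 = lb ^+ 2 * (a + b) ^+ 2.
    by rewrite -exprMn divfK ?gt_eqF.
  by rewrite ltr_pM2l // exprn_gt0 // divr_gt0.
rewrite -subset0 => z [/(interior_disk_lt a0) xz /(interior_disk_lt b0) yz].
move: far; rewrite leNgt => /negP[].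
have yz' : (z.1 - y.1) ^+ 2 + (z.2 - y.2) ^+ 2 < b ^+ 2.
  by move: yz; rewrite /sqdist -sqrrN opprB -(sqrrN (y.2 - _)) opprB.
have := sqsumD_lt a0 b0 xz yz'.
by rewrite !addrA !subrK.
Qed.

Lemma disk_in_square x a s : 0 <= a ->
  disk x a `<=` square s <->
  (a <= x.1 /\ x.1 <= s - a) /\ (a <= x.2 /\ x.2 <= s - a).
Proof.
move=> a0; split=> [sub|[[x1 x1'] [x2 x2']] z].
  have h (c1 c2 : R) : c1 ^+ 2 + c2 ^+ 2 <= a ^+ 2 ->
      square s (x.1 + c1, x.2 + c2).
    move=> c; apply: sub; apply/diskE => //; rewrite /sqdist /=.
    by rewrite !opprD !addrA !subrr !add0r !sqrrN.
  have [] := h a 0; first by lra.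
  have [] := h (- a) 0; first by lra.
  have [] := h 0 a; first by lra.
  have [] := h 0 (- a); first by lra.
  by rewrite /=; lra.
move/(diskE _ _ a0); rewrite /sqdist => xz.
have h (u v : R) : u ^+ 2 + v ^+ 2 <= a ^+ 2 -> - a <= u <= a.
  move=> uv; rewrite -ler_norml -ler_sqr ?nnegrE ?normr_ge0 //.
  by rewrite real_normK ?num_real //; have := sqr_ge0 v; lra.
have := h _ _ xz; have := h (x.2 - z.2) (x.1 - z.1).
by rewrite addrC => /(_ xz); rewrite /square /=; lra.
Qed.

(** With horizontally aligned centres, as needed to line up disks along a
    diameter, inclusion is a matter of intervals. *)
Lemma disk_in_disk x y a b : 0 <= a -> x.2 = y.2 ->
  y.1 - (b - a) <= x.1 <= y.1 + (b - a) -> disk x a `<=` disk y b.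
Proof.
move=> a0 e xy z /(diskE _ _ a0); rewrite /sqdist e => xz.
have b0 : 0 <= b by lra.
apply/diskE => //; rewrite /sqdist.
have uv : - a <= x.1 - z.1 <= a.
  rewrite -ler_norml -ler_sqr ?nnegrE ?normr_ge0 // real_normK ?num_real //.
  by have := sqr_ge0 (y.2 - z.2); lra.
set u := x.1 - z.1 in uv xz; pose d := y.1 - x.1.
have -> : y.1 - z.1 = d + u by rewrite /d /u; ring.
have dab : `|d| <= b - a by rewrite ler_norml /d; lra.
have du : d * u <= `|d| * a.
  rewrite (le_trans (ler_norm _)) // normrM ler_wpM2l ?normr_ge0 //.
  by rewrite ler_norml.
have d2 : d ^+ 2 = `|d| ^+ 2 by rewrite real_normK ?num_real.
have : (`|d| + a) ^+ 2 <= b ^+ 2.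
  by rewrite ler_sqr ?nnegrE ?addr_ge0 ?normr_ge0 //; lra.
have -> : (`|d| + a) ^+ 2 = d ^+ 2 + 2 * (`|d| * a) + a ^+ 2 by rewrite d2; ring.
have -> : (d + u) ^+ 2 = d ^+ 2 + 2 * (d * u) + u ^+ 2 by ring.
lra.
Qed.

(** Two points of a disk are at most a diameter apart; the parallelogram law
    makes this an inequality between squares. *)
Lemma sqdist_le_diameter h y z : 0 <= h ->
  disk (0, 0) h y -> disk (0, 0) h z -> sqdist y z <= (2 * h) ^+ 2.
Proof.
move=> h0 /(diskE _ _ h0) + /(diskE _ _ h0); rewrite /sqdist /= !sub0r !sqrrN.
move=> yh zh; have := sqr_ge0 (y.1 + z.1); have := sqr_ge0 (y.2 + z.2).
lra.
Qed.

Lemma disk_in_disk0 x a h : 0 <= a -> 0 <= h ->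
  disk x a `<=` disk (0, 0) h -> a <= h.
Proof.
move=> a0 h0 sub.
have h' c : `|c| <= a -> disk (0, 0) h (x.1 + c, x.2).
  move=> ca; apply: sub; apply/diskE => //; rewrite /sqdist /=.
  rewrite subrr expr0n addr0 opprD addrA subrr add0r sqrrN.
  by rewrite -(real_normK (num_real c)) ler_sqr ?nnegrE ?normr_ge0.
have := sqdist_le_diameter h0 (h' a _) (h' (- a) _).
rewrite normrN ger0_norm // => /(_ (lexx _) (lexx _)).
rewrite /sqdist /= => le2.
have : (2 * a) ^+ 2 <= (2 * h) ^+ 2 by lra.
by rewrite ler_sqr ?nnegrE ?mulr_ge0 // ler_pM2l.
Qed.

(** The line through the centres leaves the two disks at points at distance at
    least [2 * (a + b)]. *)
Lemma two_disks_in_disk x y a b h : 0 < a -> 0 < b -> 0 <= h ->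
  disk x a `<=` disk (0, 0) h -> disk y b `<=` disk (0, 0) h ->
  (a + b) ^+ 2 <= sqdist x y -> a + b <= h.
Proof.
move=> a0 b0 h0 xh yh far.
have ab0 : 0 < a + b by rewrite addr_gt0.
pose d := Num.sqrt (sqdist x y).
have d2 : d ^+ 2 = sqdist x y.
  by rewrite sqr_sqrtr // /sqdist addr_ge0 ?sqr_ge0.
have dab : a + b <= d.
  by rewrite -ler_sqr ?nnegrE ?sqrtr_ge0 ?(ltW ab0) // d2.
have d0 : 0 < d by apply: lt_le_trans dab.
pose u1 := (x.1 - y.1) / d; pose u2 := (x.2 - y.2) / d.
have u : u1 ^+ 2 + u2 ^+ 2 = 1.
  rewrite /u1 /u2 !expr_div_n -mulrDl -/(sqdist x y) -d2.
  by rewrite divff // expf_neq0 ?gt_eqF.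
have e1 : x.1 - y.1 = d * u1 by rewrite /u1 mulrC divfK ?gt_eqF.
have e2 : x.2 - y.2 = d * u2 by rewrite /u2 mulrC divfK ?gt_eqF.
clearbody u1 u2.
have px : disk (0, 0) h (x.1 + a * u1, x.2 + a * u2).
  apply/xh/diskE; first exact: ltW.
  rewrite /sqdist /= !opprD !addrA !subrr !add0r.
  by rewrite !sqrrN !exprMn -mulrDr u mulr1.
have py : disk (0, 0) h (y.1 - b * u1, y.2 - b * u2).
  apply/yh/diskE; first exact: ltW.
  rewrite /sqdist /= !subKr.
  by rewrite !exprMn -mulrDr u mulr1.
have := sqdist_le_diameter h0 px py; rewrite /sqdist /=.
have -> : x.1 + a * u1 - (y.1 - b * u1) = (d + a + b) * u1.
  by rewrite -(subrK y.1 x.1) e1; ring.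
have -> : x.2 + a * u2 - (y.2 - b * u2) = (d + a + b) * u2.
  by rewrite -(subrK y.2 x.2) e2; ring.
rewrite !exprMn -mulrDr u mulr1.
rewrite -exprMn ler_sqr ?nnegrE; lra.
Qed.

End Disks.

(** * Packings *)

Section Packing.
Variable R : realType.
Implicit Types (s t : R) (D : set (R * R)).

Lemma packable_subset (I : finType) (r : I -> R) (A B : {set I}) D :
  A \subset B -> packable r B D -> packable r A D.
Proof.
move=> /fintype.subsetP AB [x [xD xx]]; exists x; split=> [i /AB|i j /AB iB /AB].
  exact: xD.
exact: xx.
Qed.

(** Lined up along a diameter, disks fit in a disk as soon as the sum of their
    radii does not exceed its radius. *)
Lemma packable_line n (r : 'I_n -> R) (B : {set 'I_n}) (y : R * R) b :
  (forall i, 0 < r i) -> \sum_(j in B) r j <= b -> packable r B (disk y b).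
Proof.
move=> r0 Bb.
pose before (i : 'I_n) := \sum_(k in B | (k < i)%N) r k.
have before0 i : 0 <= before i by apply: sumr_ge0 => k _; exact: ltW.
have before_lt i (Q : pred 'I_n) : i \in B ->
    (forall k : 'I_n, (k <= i)%N -> Q k) ->
    before i + r i <= \sum_(k in B | Q k) r k.
  move=> iB Qi; rewrite (bigD1 i) /= ?iB ?Qi // [leLHS]addrC lerD2l.
  rewrite [leRHS](bigID (fun k : 'I_n => (k < i)%N)) /=.
  rewrite [X in _ <= X + _](_ : _ = before i) ?lerDl.
    by apply: sumr_ge0 => k _; exact: ltW.
  apply: eq_bigl => k; have [ki|] := ltnP k i; last by rewrite !andbF.
  by rewrite Qi ?(ltnW ki) // -(inj_eq val_inj) /= ltn_eqF // !andbT.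
exists (fun i => (y.1 - b + 2 * before i + r i, y.2)); split=> [i iB|].
  apply: disk_in_disk => //=; first exact: ltW.
  have := before_lt i predT iB (fun _ _ => isT); have := before0 i.
  rewrite [X in _ -> _ <= X -> _](eq_bigl (mem B)); last by move=> k; rewrite andbT.
  by move: Bb; lra.
move=> i j; wlog ij : i j / (i < j)%N => [hw iB jB|iB jB _].
  have [ij|ji|/val_inj->] := ltngtP i j; last by rewrite eqxx.
    exact: hw.
  by move=> _; rewrite setIC; apply: hw => //; rewrite -(inj_eq val_inj) ltn_eqF.
apply/interior_disjointP => //; rewrite /sqdist /= subrr expr0n addr0 -[leRHS]sqrrN.
have := before_lt i (fun k => k < j)%N iB (fun k ki => leq_ltn_trans ki ij).
rewrite -/(before j) => le_before; have := r0 i; have := r0 j => rj ri.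
rewrite ler_sqr ?nnegrE; lra.
Qed.

(** The disks of [B], lined up inside the disk vacated by [i], stay clear of
    those of [A] because that disk did. *)
Lemma packable_refill n (r : 'I_n -> R) (A B : {set 'I_n}) i D :
  (forall i, 0 < r i) -> i \notin A -> packable r (i |: A)%SET D ->
  \sum_(j in B) r j <= r i -> packable r (A :|: B)%SET D.
Proof.
move=> r0 iA [x [xD xx]] /(packable_line (x i) r0)[y [yi yy]].
have mem_AB j : j \in (A :|: B)%SET -> j \notin B -> j \in A.
  by rewrite finset.inE => /orP[//|->].
have x_y j k : j \in A -> k \in B ->
    (disk (x j) (r j))° `&` (disk (y k) (r k))° = set0.
  move=> jA kB; have ji : j != i by apply: contraNneq iA => <-.
  have := xx j i (finset.setU1r _ jA) (finset.setU11 _ _) ji.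
  by apply: subsetI_eq0 => //; apply: interiorS; exact: yi.
exists (fun j => if j \in B then y j else x j); split=> [j jC|j k jC kC jk].
  case: ifPn => [/yi|/(mem_AB _ jC) jA]; last exact/xD/finset.setU1r.
  by move=> /subset_trans; apply; exact/xD/finset.setU11.
case: ifPn => jB; case: ifPn => kB.
- exact: yy.
- by rewrite setIC; apply: x_y => //; exact: mem_AB.
- by apply: x_y => //; exact: mem_AB.
- by apply: xx => //; apply/finset.setU1r/mem_AB.
Qed.

Lemma packable_le_radius (I : finType) (r : I -> R) (C : {set I}) i h :
  0 < r i -> 0 <= h -> i \in C -> packable r C (disk (0, 0) h) -> r i <= h.
Proof.
by move=> r0 h0 iC [x [xD _]]; apply: disk_in_disk0 (xD i iC) => //; exact: ltW.
Qed.

Lemma packable_pair_le_radius (I : finType) (r : I -> R) (C : {set I}) i j h :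
  0 < r i -> 0 < r j -> 0 <= h -> i \in C -> j \in C -> i != j ->
  packable r C (disk (0, 0) h) -> r i + r j <= h.
Proof.
move=> ri rj h0 iC jC ij [x [xD xx]].
apply: two_disks_in_disk (xD i iC) (xD j jC) _ => //.
by apply/interior_disjointP => //; exact: xx.
Qed.

(** Two disks in opposite corners of the square. *)
Lemma packable_pair_square (I : finType) (r : I -> R) i j s :
  0 < r i -> 0 < r j -> i != j -> 2 * r i <= s -> 2 * r j <= s ->
  (r i + r j) ^+ 2 <= 2 * (s - (r i + r j)) ^+ 2 ->
  packable r [set i; j]%SET (square s).
Proof.
move=> ri rj ij is_ js_ far.
pose x k := if k == i then (r i, r i) else (s - r j, s - r j) : R * R.
have xi : x i = (r i, r i) by rewrite /x eqxx.
have xj : x j = (s - r j, s - r j) by rewrite /x eq_sym (negPf ij).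
have dis : (disk (x i) (r i))° `&` (disk (x j) (r j))° = set0.
  apply/interior_disjointP => //; rewrite xi xj /sqdist /=.
  have -> : r i - (s - r j) = - (s - (r i + r j)) by ring.
  by rewrite !sqrrN; move: far; rewrite mulrDl !mul1r.
exists x; split=> [k|k l].
  rewrite !finset.inE => /orP[]/eqP->; (apply/disk_in_square; first exact: ltW);
    by rewrite ?xi ?xj /=; lra.
rewrite !finset.inE => /orP[]/eqP-> /orP[]/eqP->; rewrite ?eqxx //.
by rewrite setIC.
Qed.

(** A point of [[-f, f]] at distance more than [f] from [p] is within [`|p|] of
    the end of the interval opposite to [p]. *)
Lemma far_points_close (e f p y z : R) :
  `|p| <= e -> `|y| <= f -> `|z| <= f ->
  f ^+ 2 < (y - p) ^+ 2 -> f ^+ 2 < (z - p) ^+ 2 -> (y - z) ^+ 2 <= e ^+ 2.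
Proof.
wlog p0 : p y z / p <= 0 => [hw pe yf zf yp zp|].
  have [p0|/ltW p0] := leP p 0; first exact: (hw p).
  rewrite -sqrrN; have -> : - (y - z) = - y - - z by ring.
  apply: (hw (- p)); rewrite ?normrN ?oppr_le0 //.
    by rewrite -opprD sqrrN.
  by rewrite -opprD sqrrN.
move=> pe yf zf yp zp.
have f0 : 0 <= f by apply: le_trans yf.
have e0 : 0 <= e by apply: le_trans pe.
have far u : `|u| <= f -> f ^+ 2 < (u - p) ^+ 2 -> f - e < u <= f.
  rewrite -(real_normK (num_real (u - p))) ltr_sqr ?nnegrE //.
  rewrite ler_norml ltr_normr => uf up.
  by move: pe; rewrite ler_norml; case/orP: up; lra.
have {}yp := far _ yf yp; have {}zp := far _ zf zp.
rewrite -(real_normK (num_real (y - z))) ler_sqr ?nnegrE //.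
by rewrite ler_norml; lra.
Qed.

(** The bound by [(r i + t) ^+ 2] says that with the disk of [i] in the middle of a
    side, disks of radius [t] in the two opposite corners would be blocked.
    Then, wherever the disk of [i] is, each coordinate of a centre of a larger
    disk differs from that of the centre of [i] by more than [s / 2 - t]; so the
    centres of [j] and [k] lie in a common square of side [s / 2 - r i], too
    small for both. *)
Lemma three_disks_not_in_square (I : finType) (r : I -> R) (C : {set I}) i j k
    s t :
  i \in C -> j \in C -> k \in C -> i != j -> i != k -> j != k ->
  0 < r i -> 0 < t -> t < r j -> t < r k ->
  (s - r i - t) ^+ 2 + (s / 2 - t) ^+ 2 <= (r i + t) ^+ 2 ->
  (s / 2 - r i) ^+ 2 < 2 * t ^+ 2 ->
  ~ packable r C (square s).
Proof.
move=> iC jC kC ij ik jk ri t0 tj tk blocked small [x [xD xx]].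
have rj : 0 < r j by lra.
have rk : 0 < r k by lra.
have box l : 0 < r l -> l \in C ->
    `|(x l).1 - s / 2| <= s / 2 - r l /\ `|(x l).2 - s / 2| <= s / 2 - r l.
  move=> rl lC; have [] := (disk_in_square (x l) s (ltW rl)).1 (xD l lC).
  by rewrite !ler_norml; lra.
have [i1 i2] := box i ri iC.
have [j1 j2] := box j rj jC.
have [k1 k2] := box k rk kC.
have boxt l m : t < r l -> `|m - s / 2| <= s / 2 - r l ->
    `|m - s / 2| <= s / 2 - t by move=> ? /le_trans; apply; lra.
have {}j1 := boxt _ _ tj j1; have {}j2 := boxt _ _ tj j2.
have {}k1 := boxt _ _ tk k1; have {}k2 := boxt _ _ tk k2.
have apart l m : l \in C -> m \in C -> l != m -> 0 < r l -> 0 < r m ->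
    (r l + r m) ^+ 2 <= sqdist (x l) (x m).
  by move=> lC mC lm rl rm; apply/interior_disjointP => //; exact: xx.
have far l : t < r l -> l \in C -> i != l ->
    (r i + t) ^+ 2 < ((x l).1 - (x i).1) ^+ 2 + ((x l).2 - (x i).2) ^+ 2.
  move=> tl lC il; have rl : 0 < r l by lra.
  have := apart l i lC iC _ rl ri; rewrite eq_sym => /(_ il); apply: lt_le_trans.
  rewrite ltr_sqr ?nnegrE; lra.
have coord u v : `|u - s / 2| <= s / 2 - r i -> `|v - s / 2| <= s / 2 - t ->
    (v - u) ^+ 2 <= (s - r i - t) ^+ 2.
  rewrite !ler_norml => us vs.
  rewrite -(real_normK (num_real (v - u))) ler_sqr ?nnegrE; last by lra.
    by rewrite ler_norml; lra.
  exact: normr_ge0.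
have close u v v' : `|u - s / 2| <= s / 2 - r i ->
    `|v - s / 2| <= s / 2 - t -> `|v' - s / 2| <= s / 2 - t ->
    (s / 2 - t) ^+ 2 < (v - u) ^+ 2 -> (s / 2 - t) ^+ 2 < (v' - u) ^+ 2 ->
    (v - v') ^+ 2 <= (s / 2 - r i) ^+ 2.
  move=> us vs vs' uv uv'.
  have := far_points_close us vs vs'.
  have e (a b c : R) : a - c - (b - c) = a - b by ring.
  by rewrite !e; apply.
have fj := far j tj jC ij; have fk := far k tk kC ik.
have c1j := coord _ _ i1 j1; have c2j := coord _ _ i2 j2.
have c1k := coord _ _ i1 k1; have c2k := coord _ _ i2 k2.
have d1 : ((x j).1 - (x k).1) ^+ 2 <= (s / 2 - r i) ^+ 2.
  by apply: close i1 j1 k1 _ _; lra.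
have d2 : ((x j).2 - (x k).2) ^+ 2 <= (s / 2 - r i) ^+ 2.
  by apply: close i2 j2 k2 _ _; lra.
have := apart j k jC kC jk rj rk; rewrite /sqdist.
have : (2 * t) ^+ 2 <= (r j + r k) ^+ 2 by rewrite ler_sqr ?nnegrE; lra.
lra.
Qed.

End Packing.

(** * Placements and the lex-max set *)

Section Instances.
Variables (R : realType) (P : instance R).
Local Notation ring := 'I_(nrings P).
Local Notation r := (ring_radius P).
Local Notation w := (ring_width P).
Implicit Types (S : {set ring}) (i j : ring) (c : container P).

Let r_gt0 i : 0 < r i := ring_radius_gt0 i.

Lemma hole_radius_ge0 j : 0 <= hole_radius j.
Proof. by rewrite /hole_radius le_max lexx. Qed.

Lemma le_hole_radius i j : (r i <= hole_radius j) = (r i <= r j - w).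
Proof. by rewrite /hole_radius le_max leNgt r_gt0. Qed.

Lemma fit_lt_index i j : r i <= r j - w -> (j < i)%N.
Proof.
have w0 := ring_width_gt0 P; move=> fit; rewrite ltnNge; apply/negP.
rewrite leq_eqVlt => /orP[/eqP/val_inj ij|/ring_radius_decr ij].
  by move: fit; rewrite ij; lra.
by lra.
Qed.

Lemma placement_packable S parent (A : {set ring}) c :
  placement S parent -> A \subset [set i in S | parent i == c]%SET ->
  packable r A (region c).
Proof. by move=> [_ /(_ c) pack] /packable_subset; apply. Qed.

Lemma feasible0 : feasible (finset.set0 : {set ring}).
Proof.
exists (fun=> None); split=> [i j|c]; first by rewrite finset.inE.
by exists (fun=> (0, 0)); split=> [i|i j]; rewrite !finset.inE.
Qed.

(** A ring lies in a larger ring, so dropping all rings from some index on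
    orphans no ring. *)
Lemma placement_prefix S parent k : placement S parent ->
  placement (S :&: [set i : ring | (i < k)%N])%SET parent.
Proof.
move=> pl; split=> [i j|c].
  rewrite !finset.inE => /andP[iS ik] /(pl.1 i j iS)[jS fit]; split=> //.
  by rewrite jS (ltn_trans (fit_lt_index fit)).
apply: placement_packable pl _; apply/fintype.subsetP => i.
by rewrite !finset.inE => /andP[/andP[-> _] ->].
Qed.

Lemma feasible_lexmax : feasible (lexmax P).
Proof.
rewrite /lexmax; elim/last_ind: (enum _) => [|s i IHs]; first exact: feasible0.
by rewrite foldl_rcons; case: asboolP.
Qed.

(** The scan decides each ring once and for all, knowing only the larger rings,
    so the outcome can be characterized by the final set. *)
Lemma lexmaxP i : i \in lexmax P <->
  feasible (i |: (lexmax P :&: [set j : ring | (j < i)%N]))%SET.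
Proof.
pose step S i := if `[< feasible (i |: S)%SET >] then (i |: S)%SET else S.
pose L s := foldl step finset.set0 s.
suff main s : pairwise (fun i j : ring => (i < j)%N) s ->
    {subset L s <= s} /\ forall i, i \in s -> (i \in L s <->
      feasible (i |: (L s :&: [set j : ring | (j < i)%N]))%SET).
  have sorted_enum : pairwise (fun i j : ring => (i < j)%N) (enum ring).
    rewrite -(pairwise_map val ltn) val_enum_ord.
    by rewrite -sorted_pairwise; [exact: iota_ltn_sorted|exact: ltn_trans].
  by have [_ /(_ i)] := main _ sorted_enum; apply; rewrite mem_enum.
elim/last_ind: s => [_|s x IHs]; first by split=> // j; rewrite finset.inE.
rewrite pairwise_rcons => /andP[/allP s_lt_x /IHs[subL IH]].
have xL : x \notin L s.
  by apply/negP => /subL/s_lt_x; rewrite ltnn.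
have mem_rcons_L j : j != x -> (j \in L (rcons s x)) = (j \in L s).
  rewrite /L foldl_rcons /step => jx; case: asboolP => // _.
  by rewrite finset.in_setU1 (negPf jx).
have below j : (j <= x)%N ->
    (L (rcons s x) :&: [set k : ring | (k < j)%N] =
     L s :&: [set k : ring | (k < j)%N])%SET.
  move=> jx; apply/finset.setP => k; rewrite !finset.inE.
  have [kj|] := ltnP k j; rewrite ?andbF // !andbT mem_rcons_L //.
  by rewrite -(inj_eq val_inj) ltn_eqF // (leq_trans kj).
split=> [j|j].
  have [->|jx] := eqVneq j x; first by rewrite mem_rcons mem_head.
  rewrite mem_rcons_L // mem_rcons finset.inE => /subL->.
  by rewrite orbT.
rewrite mem_rcons finset.inE => /predU1P[->|js].
  rewrite below //.
  have -> : (L s :&: [set k : ring | (k < x)%N] = L s)%SET.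
    by apply/finset.setIidPl/fintype.subsetP => k /subL/s_lt_x; rewrite finset.inE.
  rewrite /L foldl_rcons -/(L s) /step; case: asboolP => fe.
    by split=> // _; rewrite finset.setU11.
  by split=> [xin|//]; move: xL; rewrite xin.
have jx := s_lt_x _ js.
rewrite mem_rcons_L ?below ?(ltnW jx) //; last by rewrite -(inj_eq val_inj) ltn_eqF.
exact: IH.
Qed.

Lemma lexmax_full : feasible ([set: ring])%SET -> lexmax P = [set: ring]%SET.
Proof.
move=> [F plF]; apply/finset.setP => i; rewrite finset.in_setT.
have [k] := ubnP i; elim: k i => // k IHk i; rewrite ltnS => ik.
apply/lexmaxP; exists F.
have -> : (i |: (lexmax P :&: [set j : ring | (j < i)%N]) =
    [set: ring] :&: [set j : ring | (j < i.+1)%N])%SET.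
  apply/finset.setP => j; rewrite !finset.inE ltnS [(j <= i)%N]leq_eqVlt val_eqE.
  by case: ltnP => ji; rewrite ?andbF // IHk // (leq_trans ji).
exact: placement_prefix.
Qed.

(** * Greedy executions for superdecreasing radii *)

Section Greedy.
Variable a : decisions P.
Hypothesis a_greedy : greedy a.
Hypothesis superdecreasing :
  forall i, \sum_(j : ring | (i < j)%N) r j <= r i.

Local Notation L := (lexmax P).

Definition agrees_below (F : ring -> container P) k :=
  forall j, (j < k)%N -> a j = if j \in L then Some (F j) else None.

Lemma admitted_fits F i c : agrees_below F i -> admits a i c ->
  forall m, c = Some m -> m \in L /\ r i <= r m - w.
Proof.
move=> agF [av pack] m cm; move: av pack; rewrite cm /=.
move=> [mi]; rewrite agF //; case: ifP => // mL _.
move/(packable_le_radius (r_gt0 i) (hole_radius_ge0 m) (finset.setU11 _ _)).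
by rewrite le_hole_radius.
Qed.

Lemma children_beforeE F i c : agrees_below F i -> children_before a i c =
  ([set j in L | F j == c] :&: [set j : ring | (j < i)%N])%SET.
Proof.
move=> agF; apply/finset.setP => j; rewrite !finset.inE andbC.
by have [ji|] := ltnP j i; rewrite ?andbF //= agF //; case: ifP.
Qed.

(** What greedy places could be placed by the lex-max set, which prefers large
    rings. *)
Lemma admitted_in_lexmax F i c : placement L F -> agrees_below F i ->
  admits a i c -> i \in L.
Proof.
move=> plF agF ad; apply/lexmaxP.
exists (fun j => if j == i then c else F j); split=> [j m|e].
  rewrite finset.in_setU1; case: eqP => [-> _ cm|_ /= jL Fj].
    have [mL fit] := admitted_fits agF ad cm; split=> //.
    by rewrite !finset.inE mL fit_lt_index ?orbT.
  have [mS fit] := (placement_prefix i plF).1 j m jL Fj; split=> //.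
  by rewrite finset.in_setU1 mS orbT.
have [<-|ce] := eqVneq c e.
  apply: packable_subset ad.2; rewrite (children_beforeE c agF).
  apply/fintype.subsetP => j; rewrite !finset.inE; case: eqP => //= _.
  by case/andP=> /andP[-> ->] ->.
apply: placement_packable plF _; apply/fintype.subsetP => j.
rewrite !finset.inE; case: eqP => [_|_ /=]; first by rewrite (negPf ce) andbF.
by case/andP=> /andP[-> _] ->.
Qed.

Lemma parent_admits F i : placement L F -> agrees_below F i -> i \in L ->
  admits a i (F i).
Proof.
move=> plF agF iL; split.
  case Fi: (F i) => [m|//]; have [mL fit] := plF.1 i m iL Fi.
  by split; [exact: fit_lt_index|rewrite agF ?fit_lt_index // mL].
apply: placement_packable plF _; rewrite (children_beforeE _ agF).
apply/fintype.subsetP => j; rewrite !finset.inE.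
by case/predU1P => [->|/andP[]//]; rewrite iL eqxx.
Qed.

(** The exchange: to follow greedy, [i] moves from its parent to the container
    [c] that greedy chose, and the smaller rings in [c] make room by moving, all
    together, into the disk that [i] leaves. *)
Lemma exchange F i c : placement L F -> agrees_below F i -> i \in L ->
  admits a i c ->
  placement L (fun j => if j == i then c
                        else if (F j == c) && (i < j)%N then F i else F j).
Proof.
move=> plF agF iL ad; split=> [j m jL|e].
  case: (j =P i) => [->|_]; first exact: (admitted_fits agF ad).
  case: ifP => [/andP[_ ij] Fi|_ Fj]; last exact: plF.1.
  have [mL fit] := plF.1 i m iL Fi; split=> //.
  by rewrite (le_trans _ fit) // ltW // ring_radius_decr.
have [Fic|Fic] := eqVneq (F i) c.
  apply: placement_packable plF _; apply/fintype.subsetP => j.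
  rewrite !finset.inE Fic => /andP[-> /=].
  case: (j =P i) => [->|_]; first by rewrite Fic.
  by case: ifP => // /andP[/eqP->].
have [->|ec] := eqVneq e c.
  apply: packable_subset ad.2; rewrite (children_beforeE c agF).
  apply/fintype.subsetP => j; rewrite !finset.inE => /andP[-> /=].
  case: (j =P i) => //= ji; case: (F j =P c) => [Fj|Fj] /=; last by case: eqP.
  by case: (ltngtP i j) => [_|//|/val_inj/esym//]; rewrite (negPf Fic).
have [->|eF] := eqVneq e (F i).
  pose A := [set j in L | (F j == F i) && (j != i)]%SET.
  have iA : i \notin A by rewrite finset.inE !eqxx /= !andbF.
  have packA : packable r (i |: A)%SET (region (F i)).
    apply: placement_packable plF _; apply/fintype.subsetP => j.
    by rewrite !finset.inE => /predU1P[->|/and3P[->->]//]; rewrite iL eqxx.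
  apply: packable_subset (packable_refill (B := [set j : ring | (i < j)%N]%SET)
    r_gt0 iA packA _); last first.
    by rewrite (eq_bigl (fun j : ring => (i < j)%N)) // => j; rewrite finset.inE.
  apply/fintype.subsetP => j; rewrite !finset.inE => /andP[-> /=].
  case: (j =P i) => [_|ji]; first by rewrite eq_sym (negPf Fic).
  by case: ifP => [/andP[_ ->]|_ ->]; rewrite ?orbT.
apply: placement_packable plF _; apply/fintype.subsetP => j.
rewrite !finset.inE => /andP[-> /=].
case: (j =P i) => [_|_]; first by rewrite eq_sym (negPf ec).
by case: ifP => // _; rewrite eq_sym (negPf eF).
Qed.

(** For [k = nrings P], agreement makes the set placed by greedy the lex-max
    set. *)
Lemma exists_agreeing_placement k : (k <= nrings P)%N ->
  exists2 F, placement L F & agrees_below F k.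
Proof.
elim: k => [_|k IHk kn].
  by have [F plF] := feasible_lexmax; exists F.
have [F plF agF] := IHk (ltnW kn).
pose i : ring := Ordinal kn.
have := a_greedy i; case ai: (a i) => [c|] => [ad|nad]; last first.
  exists F => // j; rewrite ltnS leq_eqVlt => /predU1P[jk|/agF//].
  have -> : j = i by exact: val_inj.
  by case: ifP => // iL; case: (nad (F i)); exact: (parent_admits (i := i)).
have iL := admitted_in_lexmax (i := i) plF agF ad.
eexists; first exact: (exchange (i := i) plF agF iL ad).
move=> j; rewrite ltnS leq_eqVlt => /predU1P[jk|jk].
  by have -> : j = i by [exact: val_inj]; rewrite iL eqxx.
have -> : (j == i) = false by rewrite -(inj_eq val_inj) ltn_eqF.
by rewrite agF // [(i < j)%N]ltnNge (ltnW jk) andbF.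
Qed.

Lemma greedy_places_lexmax : placed a = L.
Proof.
have [F _ agF] := exists_agreeing_placement (leqnn _).
by apply/finset.setP => i; rewrite finset.inE agF //; case: ifP.
Qed.

End Greedy.

Lemma superdecreasing_of_rho_lt1 : rho P < 1 ->
  forall i, \sum_(j : ring | (i < j)%N) r j <= r i.
Proof.
move=> rho1 i; rewrite ltW // -[ltRHS]mul1r -ltr_pdivrMr //.
by apply: le_lt_trans rho1; rewrite /rho; exact: (le_bigmax _ (fun i => _ / _) i).
Qed.

Lemma greedy_fails_rho_ge1 : greedy_fails P -> 1 <= rho P.
Proof.
move=> [a [a_greedy fail]]; rewrite leNgt; apply/negP => rho1; apply: fail.
by apply: greedy_places_lexmax => //; exact: superdecreasing_of_rho_lt1.
Qed.

End Instances.

(** * Four rings on which best fit fails *)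

Section FourRings.
Variables (R : realType) (b c d s t : R).

(** [pair_fits] puts the rings [1] and [b] in the pan, while [b_le_cd] tempts
    best fit to hide [b] in the hole, of radius [c + d], of the largest ring.
    The hole of [b] rejects [c] and [d] by [bc_lt1], that of [c] rejects [d] by
    [c_lt_half], and the pan rejects [d] by the last two conditions, which make
    [1] and two disks of radius more than [t] unpackable. *)
Record four_ring_data : Prop := FourRingData {
  t_gt0 : 0 < t;
  t_lt_d : t < d;
  d_lt_c : d < c;
  c_lt_b : c < b;
  c_lt_half : c < 1 / 2;
  bc_lt1 : b + c < 1;
  b_le_cd : b <= c + d;
  two_le_s : 2 <= s;
  pair_fits : (1 + b) ^+ 2 <= 2 * (s - (1 + b)) ^+ 2;
  triple_blocked : (s - 1 - t) ^+ 2 + (s / 2 - t) ^+ 2 <= (1 + t) ^+ 2;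
  corner_small : (s / 2 - 1) ^+ 2 < 2 * t ^+ 2
}.

Hypothesis H : four_ring_data.

Definition four_radii (i : 'I_4) : R := [:: 1; b; c; d]`_i.

Lemma four_radii_gt0 i : 0 < four_radii i.
Proof.
by case: i => -[|[|[|[|//]]]] ?; rewrite /four_radii /=; case: H; lra.
Qed.

Lemma four_radii_decr (i j : 'I_4) :
  (i < j)%N -> four_radii j < four_radii i.
Proof.
by case: i j => -[|[|[|[|//]]]] ? [[|[|[|[|//]]]] ?] //= _;
  rewrite /four_radii /=; case: H; lra.
Qed.

Lemma four_width_gt0 : 0 < 1 - c - d.
Proof. by case: H; lra. Qed.

Lemma four_side_gt0 : 0 < s.
Proof. by case: H; lra. Qed.

Definition four_rings : instance R :=
  Instance four_radii_gt0 four_radii_decr four_width_gt0 four_side_gt0.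

Local Notation P := four_rings.
Local Notation ring := 'I_(nrings P).

Definition ring0 : ring := @Ordinal 4 0 isT.
Definition ring1 : ring := @Ordinal 4 1 isT.
Definition ring2 : ring := @Ordinal 4 2 isT.
Definition ring3 : ring := @Ordinal 4 3 isT.

Lemma ring_ind (Q : ring -> Prop) :
  Q ring0 -> Q ring1 -> Q ring2 -> Q ring3 -> forall i, Q i.
Proof.
move=> Q0 Q1 Q2 Q3 [[|[|[|[|//]]]] hi].
- by rewrite (_ : Ordinal hi = ring0) //; exact: val_inj.
- by rewrite (_ : Ordinal hi = ring1) //; exact: val_inj.
- by rewrite (_ : Ordinal hi = ring2) //; exact: val_inj.
- by rewrite (_ : Ordinal hi = ring3) //; exact: val_inj.
Qed.

Let r_gt0 (i : ring) : 0 < ring_radius P i := ring_radius_gt0 i.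

Lemma hole_ring0 : hole_radius ring0 = c + d.
Proof.
rewrite /hole_radius /= /four_radii /= max_r; first by ring.
by case: H; lra.
Qed.

Lemma hole1_too_small (i : ring) :
  (1 < i)%N -> hole_radius ring1 < ring_radius P i.
Proof.
by elim/ring_ind: i => // _; rewrite /hole_radius /= /four_radii /= gt_max;
  case: H; lra.
Qed.

Lemma hole2_too_small : hole_radius ring2 < ring_radius P ring3.
Proof. by rewrite /hole_radius /= /four_radii /= gt_max; case: H; lra. Qed.

Lemma pan_pair (i : ring) : (0 < i)%N ->
  packable (ring_radius P) [set ring0; i]%SET (region (None : container P)).
Proof.
move=> i0; have i_b : ring_radius P i <= b.
  by move: i0; elim/ring_ind: i => //= _; rewrite /four_radii /=; case: H; lra.
have ri := r_gt0 i; rewrite /region.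
have e0 : ring_radius P ring0 = 1 by [].
have e1 : pan_side P = s by [].
apply: packable_pair_square; rewrite ?e0 ?e1 //; move: ri i_b;
  move: (ring_radius P i) => u u0 ub; case: H => *.
- by rewrite -val_eqE /= eq_sym -lt0n.
- lra.
- lra.
- have : (1 + u) ^+ 2 <= (1 + b) ^+ 2 by rewrite ler_sqr ?nnegrE; lra.
  have : (s - (1 + b)) ^+ 2 <= (s - (1 + u)) ^+ 2 by rewrite ler_sqr ?nnegrE; lra.
  lra.
Qed.

Lemma four_feasible : feasible [set: ring]%SET.
Proof.
pose F (i : ring) : container P := if (i < 2)%N then None else Some ring0.
exists F; split=> [i j _|[j|]].
- by elim/ring_ind: i => // -[<-]; split; rewrite ?finset.inE //= /four_radii /=;
    case: H; lra.
- apply: packable_line => //.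
  rewrite big_mkcond !big_ord_recl big_ord0 !finset.inE /F /= /four_radii /=.
  elim/ring_ind: j; rewrite /= ?hole_ring0 ?addr0 ?add0r //;
    exact: hole_radius_ge0.
- apply: packable_subset (pan_pair (i := ring1) isT).
  by apply/fintype.subsetP; elim/ring_ind; rewrite !finset.inE.
Qed.

Definition best_fit_run (i : ring) : option (container P) :=
  nth None [:: Some None; Some (Some ring0); Some None; None] i.

Lemma too_large_not_admitted (i j : ring) :
  hole_radius j < ring_radius P i -> ~ admits best_fit_run i (Some j).
Proof.
move=> ij [_ pack].
have := packable_le_radius (r_gt0 i) (hole_radius_ge0 j) (finset.setU11 _ _) pack.
by rewrite leNgt ij.
Qed.

(** That hole has radius [c + d], and [b], already in it, exceeds [c] and [d]. *)
Lemma hole0_full (i : ring) : (1 < i)%N ->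
  ~ admits best_fit_run i (Some ring0).
Proof.
move=> i1 [_ pack]; have : ring_radius P i + ring_radius P ring1 <= c + d.
  rewrite -hole_ring0; apply: packable_pair_le_radius pack => //.
  - exact: hole_radius_ge0.
  - exact: finset.setU11.
  - by rewrite !finset.inE i1 orbT.
  - by rewrite -val_eqE /= gt_eqF.
by move: i1; elim/ring_ind: i {pack} => //= _; rewrite /four_radii /=; case: H; lra.
Qed.

Lemma best_fit_run_greedy : greedy best_fit_run.
Proof.
elim/ring_ind => /=.
- split=> //; apply: packable_subset (pan_pair (i := ring1) isT).
  by apply/fintype.subsetP; elim/ring_ind; rewrite !finset.inE.
- split=> //; rewrite /region hole_ring0; apply: packable_line => //.
  rewrite (eq_bigl (pred1 ring1)).
    by rewrite big_pred1_eq /= /four_radii /=; case: H.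
  by elim/ring_ind; rewrite !finset.inE.
- split=> //; apply: packable_subset (pan_pair (i := ring2) isT).
  by apply/fintype.subsetP; elim/ring_ind; rewrite !finset.inE.
- case=> [|[_ /=]].
    elim/ring_ind; last by case; case.
    + exact: hole0_full.
    + exact/too_large_not_admitted/hole1_too_small.
    + exact/too_large_not_admitted/hole2_too_small.
  apply: (@three_disks_not_in_square _ _ _ _ ring0 ring2 ring3 s t) => //;
    by rewrite ?finset.inE //= /four_radii /=; case: H => *; lra.
Qed.

Lemma four_best_fit_fails : best_fit_fails P.
Proof.
exists best_fit_run; split; last first.
  rewrite lexmax_full; last exact: four_feasible.
  by move/finset.setP/(_ ring3); rewrite !finset.inE.
split; first exact: best_fit_run_greedy.
have available_lt (i j : ring) : admits best_fit_run i (Some j) -> (j < i)%N.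
  by case=> -[].
elim/ring_ind => e e' //= [<-].
- by case: e' => [j /available_lt|//].
- case: e' => [j /available_lt|_]; first by elim/ring_ind: j.
  by rewrite /capacity hole_ring0; case: H => *; rewrite /=; lra.
- case: e' => [j ad|//]; have := available_lt _ _ ad; move: ad.
  elim/ring_ind: j => // [/(hole0_full (i := ring2) isT)//|].
  by move/(too_large_not_admitted (hole1_too_small (i := ring2) isT)).
Qed.

Lemma le_rho_four : (c + d) / b <= rho P.
Proof.
have := le_bigmax 0 (fun i : ring =>
  (\sum_(j : ring | (i < j)%N) ring_radius P j) / ring_radius P i) ring1.
apply: le_trans.
by rewrite big_mkcond !big_ord_recl big_ord0 /= /four_radii /= !add0r addr0.
Qed.

Lemma rho_four_lt M : 3 / 2 <= M -> (c + d) / b < M -> rho P < M.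
Proof.
move=> M1 M2; apply: bigmax_lt; first lra.
elim/ring_ind => _; rewrite big_mkcond !big_ord_recl big_ord0 /= /four_radii /=;
  rewrite ?add0r ?addr0 //.
- by rewrite divr1; case: H => *; lra.
- by case: H => *; rewrite ltr_pdivrMr; [nra|lra].
- by rewrite mul0r; lra.
Qed.

End FourRings.

(** * The critical value *)

Section Root.
Variable R : realType.
Definition quad (y : R) : R :=
  (17 + 10 * Num.sqrt 2) * y ^+ 2 + (72 + 16 * Num.sqrt 2) * y
    - (112 + 96 * Num.sqrt 2).

Lemma sqrt2_bounds :
  let u : R := 1 + 414 / 10 ^+ 3 + 213 / 10 ^+ 6 + 562 / 10 ^+ 9
                 + 373 / 10 ^+ 12 + 95 / 10 ^+ 15 + 48 / 10 ^+ 18 in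
  u < Num.sqrt 2 :> R /\ Num.sqrt 2 < u + 1 / 10 ^+ 18 :> R.
Proof.
have q2 : (Num.sqrt 2 : R) ^+ 2 = 2 by rewrite sqr_sqrtr.
have q0 : 0 <= (Num.sqrt 2 : R) := sqrtr_ge0 2.
have lo (x : R) : 0 <= x -> x ^+ 2 < 2 -> x < Num.sqrt 2.
  by move=> x0 x2; rewrite -ltr_sqr ?nnegrE // q2.
have hi (x : R) : 0 <= x -> 2 < x ^+ 2 -> Num.sqrt 2 < x.
  by move=> x0 x2; rewrite -ltr_sqr ?nnegrE // q2.
by split; [apply: lo|apply: hi]; lra.
Qed.

(** Being increasing on the positive half-line, the quadratic has at most one
    positive root, located by the sign of its values. *)
Lemma quad_lt (y z : R) : 0 < y -> y < z -> quad y < quad z.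
Proof.
move=> y0 yz; have q0 := sqrtr_ge0 (2 : R); rewrite /quad.
rewrite ltrD2r ltrD // ltr_pM2l // ?ltr_sqr ?nnegrE; lra.
Qed.

Definition quad_root : R :=
  let a := 17 + 10 * Num.sqrt 2 in let b := 72 + 16 * Num.sqrt 2 in
  (Num.sqrt (b ^+ 2 + 4 * a * (112 + 96 * Num.sqrt 2)) - b) / (2 * a).

Lemma quad_quad_root : quad quad_root = 0.
Proof.
rewrite /quad_root /quad; have q0 := sqrtr_ge0 (2 : R).
set q := Num.sqrt 2 in q0 *; set D := _ + _ * (112 + _).
have D0 : 0 <= D by rewrite /D addr_ge0 ?sqr_ge0 ?mulr_ge0 //; lra.
have D2 := sqr_sqrtr D0; move: (Num.sqrt D) D2 => p D2.
have a0 : 17 + 10 * q != 0 by rewrite gt_eqF //; lra.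
have -> : (17 + 10 * q) * ((p - (72 + 16 * q)) / (2 * (17 + 10 * q))) ^+ 2 +
  (72 + 16 * q) * ((p - (72 + 16 * q)) / (2 * (17 + 10 * q))) - (112 + 96 * q)
  = (p ^+ 2 - D) / (4 * (17 + 10 * q)) by rewrite /D; field.
by rewrite D2 subrr mul0r.
Qed.

Lemma quad_root_gt0 : 0 < quad_root.
Proof.
have q0 := sqrtr_ge0 (2 : R); rewrite /quad_root.
apply: divr_gt0; last by lra.
rewrite subr_gt0 -[ltLHS]ger0_norm; last by lra.
rewrite -sqrtr_sqr ltr_sqrt; first by rewrite ltrDl !mulr_gt0 //; lra.
by rewrite ltr_wpDl ?sqr_ge0 // !mulr_gt0 //; lra.
Qed.

Lemma quad_root_bounds :
  let Y0 : R := 1 + 684 / 10 ^+ 3 + 487 / 10 ^+ 6 + 745 / 10 ^+ 9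
                     + 872 / 10 ^+ 12 + 348 / 10 ^+ 15 in
  Y0 <= quad_root < Y0 + 1 / 10 ^+ 15.
Proof.
have Y0 := quad_root_gt0; have Yq := quad_quad_root.
have [lo hi] := sqrt2_bounds.
apply/andP; split; [rewrite leNgt|rewrite ltNge]; apply/negP.
  move/(quad_lt Y0); rewrite Yq /quad; move: (Num.sqrt 2) lo hi => q lo hi.
  apply/negP; rewrite -leNgt; lra.
rewrite le_eqVlt => /predU1P[e|]; last first.
  move/quad_lt; rewrite Yq /quad; move: (Num.sqrt 2) lo hi => q lo hi.
  move=> h; have := h ltac:(lra); lra.
move: Yq; rewrite -e /quad; lra.
Qed.

(** The two small radii of the limit configuration, when the largest radius is
    [1]; the second radius is then [1 - threshold = 2 / (quad_root + 2)]. *)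
Definition threshold : R := quad_root / (quad_root + 2).

(** Side of the square in which disks of radii [a] and [b] just fit, relative
    to [a + b]. *)
Definition corner_ratio : R := 1 + Num.sqrt 2 / 2.

Lemma quad_root_approx : 168 / 100 < quad_root < 169 / 100.
Proof.
have /andP[] := quad_root_bounds; move: quad_root => y.
by move=> lo hi; apply/andP; split; lra.
Qed.

(** Clearing the denominator [(Y + 2) ^+ 2] turns this into the equation of
    [quad_root], up to the factor [- 1 / 8] and a multiple of
    [Num.sqrt 2 ^+ 2 - 2]. *)
Lemma threshold_blocked : let s := corner_ratio * (2 - threshold) in
  (s - 1 - threshold) ^+ 2 + (s / 2 - threshold) ^+ 2 = (1 + threshold) ^+ 2.
Proof.
have /andP[lo hi] := quad_root_approx; have := quad_quad_root.
rewrite /threshold /quad /corner_ratio; move: quad_root lo hi => y lo hi Yq.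
have q2 : (Num.sqrt 2 : R) ^+ 2 = 2 by rewrite sqr_sqrtr.
move: (Num.sqrt 2) q2 Yq => q q2 Yq /=.
have y2 : y + 2 != 0 by rewrite gt_eqF //; lra.
apply/eqP; rewrite -subr_eq0; apply/eqP.
rewrite (_ : _ - _ = (- ((17 + 10 * q) * y ^+ 2 + (72 + 16 * q) * y
    - (112 + 96 * q)) / 8 + (q ^+ 2 - 2) * (5 * (y + 4) ^+ 2 / 16))
    / (y + 2) ^+ 2); last by field.
by rewrite Yq q2 subrr mul0r oppr0 mul0r add0r mul0r.
Qed.

End Root.

(** * Rational instances close to the critical value *)

Section Approximation.
Variable R : realType.
Local Notation Y := (quad_root R).
Local Notation t := (threshold R).
Local Notation kappa := (corner_ratio R).

(** The blocking condition holds because the side stays below its limit value,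
    and the pair fits because the side stays above what [1] and [b] require; the
    rest follows from rough bounds on [Y] and [Num.sqrt 2]. *)
Lemma four_ring_data_near b c d s :
  1 / 2 < b -> b < 1 - t -> t < d -> d < c -> c < 1 - b ->
  kappa * (1 + b) < s -> s < kappa * (2 - t) -> four_ring_data b c d s t.
Proof.
move=> b_lo b_hi d_lo dc c_hi s_lo s_hi.
have /andP[Ylo Yhi] := quad_root_approx R.
have tlo : 45 / 100 < t by rewrite /threshold ltr_pdivlMr; lra.
have thi : t < 46 / 100 by rewrite /threshold ltr_pdivrMr; lra.
have [qlo qhi] : 141 / 100 < Num.sqrt 2 :> R /\ Num.sqrt 2 < 142 / 100 :> R.
  by have [lo hi] := sqrt2_bounds R; split; lra.
have kappa_lo : 170 / 100 < kappa by rewrite /corner_ratio; lra.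
have kappa_hi : kappa < 171 / 100 by rewrite /corner_ratio; lra.
have s2 : 2 <= s.
  have : 170 / 100 * (3 / 2) <= kappa * (1 + b) by apply: ler_pM; lra.
  lra.
have s3 : s < 266 / 100.
  have : kappa * (2 - t) <= 171 / 100 * (155 / 100) by apply: ler_pM; lra.
  lra.
have far_square u v : 0 <= u -> u <= v -> u ^+ 2 <= v ^+ 2 :> R.
  by move=> u0 uv; rewrite ler_sqr ?nnegrE; lra.
split; try lra.
- have -> : (1 + b) ^+ 2 = 2 * (kappa * (1 + b) - (1 + b)) ^+ 2.
    have q2 : (Num.sqrt 2 : R) ^+ 2 = 2 by rewrite sqr_sqrtr.
    rewrite /corner_ratio.
    have -> : (1 + Num.sqrt 2 / 2) * (1 + b) - (1 + b) = Num.sqrt 2 / 2 * (1 + b).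
      by ring.
    by rewrite !exprMn q2; field.
  rewrite ler_pM2l //; apply: far_square; last by lra.
  by rewrite -[X in _ - X]mul1r -mulrBl mulr_ge0; lra.
- have := threshold_blocked R; rewrite -/kappa /= => <-.
  by apply: lerD; apply: far_square; lra.
- have := far_square (s / 2 - 1) (33 / 100) ltac:(lra) ltac:(lra).
  have := far_square (45 / 100) t ltac:(lra) ltac:(lra).
  lra.
Qed.

Lemma rational_between (x y : R) : x < y -> exists2 q : rat, x < ratr q & ratr q < y.
Proof.
by move=> /rat_in_itvoo[q]; rewrite in_itv /= => /andP[xq qy]; exists q.
Qed.

Lemma exists_failing_four_rings e : 0 < e -> exists P : instance R,
  [/\ nrings P = 4%N,
      (forall i, rational (ring_radius P i)) /\ rational (ring_width P) /\
        rational (pan_side P),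
      best_fit_fails P & Y < rho P < Y + e].
Proof.
move=> e0; have /andP[Ylo Yhi] := quad_root_approx R.
have t1 : 1 - t = 2 / (Y + 2) by rewrite /threshold; field; rewrite gt_eqF; lra.
(* As [c] and [d] will be below [1 - b], the ratio is below [2 * (1 - b) / b],
   which is at most [Y + e] when [b] is at least [2 / (Y + 2 + e)]. *)
have [qb b_lo b_hi] : exists2 q : rat,
    Num.max (1 / 2) (2 / (Y + 2 + e)) < ratr q & ratr q < 1 - t.
  apply: rational_between; rewrite gt_max t1; apply/andP; split.
    by rewrite ltr_pdivlMr; lra.
  by rewrite ltr_pM2l // ltf_pV2 ?posrE; lra.
move: b_lo; rewrite gt_max => /andP[b_half b_lo].
have {}b_lo : 2 < ratr qb * (Y + 2 + e) by move: b_lo; rewrite ltr_pdivrMr; lra.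
have t_lt : t < 1 - ratr qb by lra.
have [qd d_lo d_hi] := rational_between t_lt.
have [qc c_lo c_hi] := rational_between d_hi.
have kappa0 : 0 < kappa by have := sqrtr_ge0 (2 : R); rewrite /corner_ratio; lra.
have [qs s_lo s_hi] : exists2 q : rat,
    kappa * (1 + ratr qb) < ratr q & ratr q < kappa * (2 - t).
  by apply: rational_between; rewrite ltr_pM2l //; lra.
have D := four_ring_data_near b_half b_hi d_lo c_lo c_hi s_lo s_hi.
exists (four_rings D); split=> //.
- split; first by apply: ring_ind; rewrite /= /four_radii /=;
    [exists 1; rewrite ?rmorph1|exists qb|exists qc|exists qd].
  by split; [exists (1 - qc - qd); rewrite ?rmorphB ?rmorph1|exists qs].
- exact: four_best_fit_fails.
have b0 : 0 < ratr qb :> R by lra.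
apply/andP; split.
  apply: lt_le_trans (le_rho_four D); rewrite ltr_pdivlMr //.
  have tY : 2 * t = Y * (1 - t) by rewrite t1 /threshold; ring.
  have : Y * ratr qb < Y * (1 - t) by rewrite ltr_pM2l; lra.
  lra.
apply: rho_four_lt; first by lra.
rewrite ltr_pdivrMr //; lra.
Qed.

End Approximation.

Unset Implicit Arguments.

Theorem theorem38 (R : realType) :
  exists Y : R,
    unique (fun y : R => 0 < y /\
      (17 + 10 * Num.sqrt 2) * y ^+ 2 + (72 + 16 * Num.sqrt 2) * y
        - (112 + 96 * Num.sqrt 2) = 0) Y /\
    (let Y0 : R := 1 + 684 / 10 ^+ 3 + 487 / 10 ^+ 6 + 745 / 10 ^+ 9
                     + 872 / 10 ^+ 12 + 348 / 10 ^+ 15 in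
     Y0 <= Y < Y0 + 1 / 10 ^+ 15) /\
    (1%:E <= tau_square R <= Y%:E)%E /\
    exists P : nat -> instance R,
      (forall k,
         nrings (P k) = 4%N /\
         (forall i, rational (ring_radius (P k) i)) /\
         rational (ring_width (P k)) /\
         rational (pan_side (P k)) /\
         best_fit_fails (P k) /\
         Y < rho (P k)) /\
      (rho (P k) @[k --> \oo] --> Y).
Proof.
exists (quad_root R); split.
  split; first by split; [exact: quad_root_gt0|exact: quad_quad_root].
  move=> y [y0 qy]; have [||//] := ltgtP (quad_root R) y.
    by move/(quad_lt (quad_root_gt0 R)); rewrite quad_quad_root /quad qy ltxx.
  by move/(quad_lt y0); rewrite quad_quad_root /quad qy ltxx.
split; first exact: quad_root_bounds.
split.
  apply/andP; split.
    apply/ereal_infP => _ [P /greedy_fails_rho_ge1 rho1 <-].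
    by rewrite lee_fin.
  apply/lee_addgt0Pr => e e0; apply: ge_ereal_inf.
  have [P [_ _ [a [[a_greedy _] fail]] /andP[_ rhoP]]] :=
    exists_failing_four_rings e0.
  by exists (rho P)%:E; [exists P => //; exists a|rewrite -EFinD lee_fin ltW].
have [P HP] := choice (fun k : nat =>
  exists_failing_four_rings (e := (k.+1%:R^-1 : R)) ltac:(by rewrite invr_gt0)).
exists P; split=> [k|].
  by have [n4 [r_rat [w_rat s_rat]] fail /andP[lo _]] := HP k.
apply: (@squeeze_cvgr _ _ _ _ (fun=> quad_root R)
  (fun k => quad_root R + harmonic k)).
- by near=> k; have [_ _ _ /andP[lo hi]] := HP k; rewrite !ltW.
- exact: cvg_cst.
- rewrite -[X in _ --> X]addr0; apply: cvgD; first exact: cvg_cst.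
  exact: cvg_harmonic.
Unshelve. all: by end_near.
Qed.
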